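(* Let $s\le d$ and $m$ be positive integers. Let $A$ be a real $m\times d$ matrix with $\|A\|_{op}=1$, and let $y=Ax^*$ for some $s$-sparse $x^*\in\mathbb{R}^d$. Let $0\le \eta\le 1$ and let the sequences $(x^t)_{t\ge 0}$, $(a^t)_{t\ge 1}$ be generated by Iterative Look Ahead Thresholding (with input $A,y,s$) with parameter $\eta$. If the restricted isometry constant $\delta_{2s}=\delta_{2s}(A)$ satisfies $$\delta_{2s}<\frac{1}{\left(1+\sqrt{1+4\eta^2}\right)^2},$$ then for all $t\ge 0$ $$\|x^t-x^*\|_2\le \rho^t\,\|x^0-x^*\|_2,$$ where $\rho=\sqrt{\delta_{2s}}\left(1+\sqrt{1+4\eta^2}\right)<1$. In particular, $(x^t)$ converges to $x^*$.
   Context: A vector is $s$-sparse if it has at most $s$ nonzero entries. $\|\cdot\|_{op}$ is the operator norm with respect to Euclidean norms; $A^*$ is the (conjugate) transpose. Restricted isometry constant: $\delta_k(A)$ is the smallest $\delta\ge 0$ such that $(1-\delta)\|x\|_2^2\le\|Ax\|_2^2\le(1+\delta)\|x\|_2^2$ for every $k$-sparse $x$. Cost: $C(x)=\|y-Ax\|_2^2$, so $\nabla C(x)=-2A^*(y-Ax)$. Look ahead thresholding: for $\Omega\subset\{1,\dots,d\}$ let $P_\Omega$ be the coordinate projection onto the coordinates in $\Omega$ (other entries set to zero). For $z\in\mathbb{R}^d$ set $$f_{\eta,z}(x)=C(z)+\sum_{i=1}^d\left(2\eta\frac{\partial C}{\partial x_i}(z)(x_i-z_i)+(x_i-z_i)^2\right),$$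 and let $H_{s,\eta}(z)$ be a minimizer of $f_{\eta,z}(P_\Omega z)$ over vectors $P_\Omega z$ with $|\Omega|=s$ (ties broken arbitrarily). Equivalently, $H_{s,\eta}(z)=P_\Omega z$ where $\Omega$ consists of the indices of the $s$ largest values of $-2\eta z_i\frac{\partial C}{\partial x_i}(z)+z_i^2$. Iterative Look Ahead Thresholding with parameter $\eta$: $x^0=0$ and, for $t\ge1$, $a^t=x^{t-1}+A^*(y-Ax^{t-1})$, $x^t=H_{s,\eta}(a^t)$. *)

(* Defs.v *)
From HB Require Import structures.
From mathcomp Require Import all_boot all_order all_algebra.
From mathcomp Require Import all_classical all_reals all_analysis.
Set Implicit Arguments.
Unset Strict Implicit.
Unset Printing Implicit Defensive.
Import Order.TTheory GRing.Theory Num.Theory.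
Import numFieldNormedType.Exports.
Local Open Scope classical_set_scope.
Local Open Scope ring_scope.

(* The library norm on matrices is the sup norm, hence a separate Euclidean
   norm. *)
Definition norm2 (R : realType) (n : nat) (x : 'cV[R]_n) : R :=
  Num.sqrt (\sum_(i < n) x i 0 ^+ 2).

Definition opnorm (R : realType) (m d : nat) (A : 'M[R]_(m, d)) : R :=
  sup [set norm2 (A *m x) | x in [set x : 'cV[R]_d | norm2 x <= 1]].

Definition sparse (R : realType) (d k : nat) (x : 'cV[R]_d) : bool :=
  (#|[set i : 'I_d | (x i 0 != 0)%R]%SET| <= k)%N.

Definition is_RIP_bound (R : realType) (m d : nat) (A : 'M[R]_(m, d))
    (k : nat) (delta : R) : Prop :=
  0 <= delta /\
  forall x : 'cV[R]_d, sparse k x ->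
    (1 - delta) * norm2 x ^+ 2 <= norm2 (A *m x) ^+ 2 /\
    norm2 (A *m x) ^+ 2 <= (1 + delta) * norm2 x ^+ 2.

(* The set of bounds is nonempty, closed and bounded below by 0, so its infimum
   is its smallest element. *)
Definition ric (R : realType) (m d : nat) (A : 'M[R]_(m, d)) (k : nat) : R :=
  inf [set delta : R | is_RIP_bound A k delta].

Definition cost (R : realType) (m d : nat) (A : 'M[R]_(m, d)) (y : 'cV[R]_m)
    (x : 'cV[R]_d) : R :=
  norm2 (y - A *m x) ^+ 2.

Definition partial (R : realType) (d : nat) (F : 'cV[R]_d -> R) (i : 'I_d)
    (z : 'cV[R]_d) : R :=
  'D_(delta_mx i 0) (F : 'cV[R]_d -> R^o) z.

Definition coord_proj (R : realType) (d : nat) (Omega : {set 'I_d})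
    (z : 'cV[R]_d) : 'cV[R]_d :=
  \col_i (if i \in Omega then z i 0 else 0).

Definition lookahead_obj (R : realType) (m d : nat) (A : 'M[R]_(m, d))
    (y : 'cV[R]_m) (eta : R) (z x : 'cV[R]_d) : R :=
  cost A y z +
  \sum_(i < d) (2 * eta * partial (cost A y) i z * (x i 0 - z i 0)
                + (x i 0 - z i 0) ^+ 2).

(* [w] is a possible value of H_{s,eta}(z); a relation, since ties may be
   broken arbitrarily. *)
Definition lookahead_threshold (R : realType) (m d : nat) (A : 'M[R]_(m, d))
    (y : 'cV[R]_m) (s : nat) (eta : R) (z w : 'cV[R]_d) : Prop :=
  exists Omega : {set 'I_d},
    [/\ #|Omega| = s,
        w = coord_proj Omega z &
        forall Omega' : {set 'I_d}, #|Omega'| = s ->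
          lookahead_obj A y eta z (coord_proj Omega z)
          <= lookahead_obj A y eta z (coord_proj Omega' z)].

(* The sequence [a] is only meaningful from index 1 on; [a 0] is
   unconstrained. *)
Definition ILAT (R : realType) (m d : nat) (A : 'M[R]_(m, d)) (y : 'cV[R]_m)
    (s : nat) (eta : R) (x a : nat -> 'cV[R]_d) : Prop :=
  x 0%N = 0 /\
  forall t : nat,
    a t.+1 = x t + A^T *m (y - A *m x t) /\
    lookahead_threshold A y s eta (a t.+1) (x t.+1).

(* Main.v *)
(** Put [G = A^T A], [e = x^t - x*], [v = a^(t+1) - x* = (1 - G) e] and
    [b = G v], so that the gradient of the cost at [a^(t+1)] is [2 b].  As
    [0 <= G <= 1], the scalar inequality [4 r (1 - r) <= 1] gives
    [|v|^2 + 4 |b|^2 <= |e|^2 - |A e|^2], and the right-hand side is at most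
    [delta_2s |e|^2].  Let [C] be a set of size [s] containing the support of
    [x*], and let [c] be [a^(t+1) - 2 eta b] restricted to [C \ Omega].
    Completing the square in the optimality of [Omega] against [C] gives
    [|c|^2 <= |v - 2 eta b|^2 + 4 eta^2 |b|^2 <= |v|^2 + 4 |b|^2], where the
    last step uses [eta <= 1], whereas the coordinates of
    [z = x^(t+1) - x* + c] are [v_i] on [Omega], [v_i - 2 eta b_i] on
    [C \ Omega] and [0] elsewhere, whence
    [|z|^2 <= (1 + 4 eta^2) (|v|^2 + 4 |b|^2)].  Combining the two bounds in
    [x^(t+1) - x* = z - c] yields the contraction factor. *)
Require Import Defs.
From HB Require Import structures.
From mathcomp Require Import all_boot all_order all_algebra.
From mathcomp Require Import all_classical all_reals all_analysis.
From mathcomp Require Import ring lra.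
Set Implicit Arguments.
Unset Strict Implicit.
Unset Printing Implicit Defensive.
Import Order.TTheory GRing.Theory Num.Theory.
Import numFieldNormedType.Exports.
Local Open Scope classical_set_scope.
Local Open Scope ring_scope.

(** * Euclidean inner product and norm *)

Definition dotmx (R : realType) (n : nat) (u v : 'cV[R]_n) : R :=
  (u^T *m v) 0 0.

Lemma dotmxE (R : realType) (n : nat) (u v : 'cV[R]_n) :
  dotmx u v = \sum_(i < n) u i 0 * v i 0.
Proof. by rewrite /dotmx !mxE; apply: eq_bigr => i _; rewrite mxE. Qed.

Lemma dotmxC (R : realType) (n : nat) (u v : 'cV[R]_n) : dotmx u v = dotmx v u.
Proof. by rewrite !dotmxE; apply: eq_bigr => i _; rewrite mulrC. Qed.

Lemma dotmxDr (R : realType) (n : nat) (u v w : 'cV[R]_n) :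
  dotmx u (v + w) = dotmx u v + dotmx u w.
Proof. by rewrite /dotmx mulmxDr mxE. Qed.

Lemma dotmxZr (R : realType) (n : nat) (c : R) (u v : 'cV[R]_n) :
  dotmx u (c *: v) = c * dotmx u v.
Proof. by rewrite /dotmx -scalemxAr mxE. Qed.

Lemma dotmxDl (R : realType) (n : nat) (u v w : 'cV[R]_n) :
  dotmx (u + v) w = dotmx u w + dotmx v w.
Proof. by rewrite !(dotmxC _ w) dotmxDr. Qed.

Lemma dotmxZl (R : realType) (n : nat) (c : R) (u v : 'cV[R]_n) :
  dotmx (c *: u) v = c * dotmx u v.
Proof. by rewrite !(dotmxC _ v) dotmxZr. Qed.

Lemma dotmxNr (R : realType) (n : nat) (u v : 'cV[R]_n) :
  dotmx u (- v) = - dotmx u v.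
Proof. by rewrite -scaleN1r dotmxZr mulN1r. Qed.

Lemma dotmxNl (R : realType) (n : nat) (u v : 'cV[R]_n) :
  dotmx (- u) v = - dotmx u v.
Proof. by rewrite !(dotmxC _ v) dotmxNr. Qed.

Lemma dotmx_mulmxl (R : realType) (m n : nat) (A : 'M[R]_(m, n))
    (u : 'cV[R]_n) (v : 'cV[R]_m) :
  dotmx (A *m u) v = dotmx u (A^T *m v).
Proof. by rewrite /dotmx trmx_mul mulmxA. Qed.

Lemma norm2_sqr (R : realType) (n : nat) (u : 'cV[R]_n) :
  norm2 u ^+ 2 = dotmx u u.
Proof.
rewrite dotmxE /norm2 sqr_sqrtr; last by apply: sumr_ge0 => i _; exact: sqr_ge0.
by apply: eq_bigr => i _; rewrite expr2.
Qed.

Lemma norm2_ge0 (R : realType) (n : nat) (u : 'cV[R]_n) : 0 <= norm2 u.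
Proof. exact: sqrtr_ge0. Qed.

Lemma dotmx_ge0 (R : realType) (n : nat) (u : 'cV[R]_n) : 0 <= dotmx u u.
Proof. by rewrite -norm2_sqr sqr_ge0. Qed.

Lemma norm2Z (R : realType) (n : nat) (c : R) (u : 'cV[R]_n) :
  norm2 (c *: u) = `|c| * norm2 u.
Proof.
apply/eqP; rewrite -(eqrXn2 (n := 2)) ?mulr_ge0 ?norm2_ge0 //.
by rewrite exprMn !norm2_sqr dotmxZl dotmxZr real_normK ?num_real // expr2 mulrA.
Qed.

Lemma normr_coord_le_norm2 (R : realType) (n : nat) (u : 'cV[R]_n) (i : 'I_n) :
  `|u i 0| <= norm2 u.
Proof.
rewrite -(ler_pXn2r (n := 2)) ?nnegrE ?norm2_ge0 //.
rewrite real_normK ?num_real // norm2_sqr dotmxE (bigD1 i) //= expr2.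
by rewrite lerDl; apply: sumr_ge0 => j _; rewrite -expr2 sqr_ge0.
Qed.

Lemma norm2_eq0 (R : realType) (n : nat) (u : 'cV[R]_n) : norm2 u = 0 -> u = 0.
Proof.
move=> u0; apply/matrixP => i j; rewrite ord1 mxE; apply/eqP.
by rewrite -normr_le0 -u0 normr_coord_le_norm2.
Qed.

(** * Consequences of operator norm one *)

Section OpnormOne.
Context (R : realType) (m d : nat) (A : 'M[R]_(m, d)).
Hypothesis A_op : opnorm A = 1.

(* [sup] is 0 on an unbounded set, so [opnorm A = 1] forces boundedness. *)
Lemma opnorm1_dotmx (u : 'cV[R]_d) : dotmx (A *m u) (A *m u) <= dotmx u u.
Proof.
rewrite -!norm2_sqr ler_pXn2r ?nnegrE ?norm2_ge0 //.
have [u0|u_neq0] := eqVneq (norm2 u) 0.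
  by rewrite u0 (norm2_eq0 u0) mulmx0 -(scale0r 0) norm2Z normr0 mul0r.
have u_gt0 : 0 < norm2 u by rewrite lt_def u_neq0 norm2_ge0.
set E := [set norm2 (A *m x) | x in [set x : 'cV[R]_d | norm2 x <= 1]].
have hE : has_sup E.
  apply: contrapT => /sup_out E0; move: A_op; rewrite /opnorm -/E E0 => /eqP.
  by rewrite eq_sym oner_eq0.
have : norm2 (A *m ((norm2 u)^-1 *: u)) <= sup E.
  apply: sup_upper_bound => //; exists ((norm2 u)^-1 *: u) => //=.
  by rewrite norm2Z ger0_norm ?invr_ge0 ?norm2_ge0 // mulVf.
rewrite (_ : sup E = 1) // -scalemxAr norm2Z ger0_norm ?invr_ge0 ?norm2_ge0 //.
by rewrite mulrC ler_pdivrMr // mul1r.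
Qed.

(** With [w = A^T u], expanding [|u - A w|^2 >= 0] gives [2 |w|^2 <= |u|^2 + |A w|^2], and
    [|A w| <= |w|]. *)
Lemma opnorm1_dotmx_tr (u : 'cV[R]_m) :
  dotmx (A^T *m u) (A^T *m u) <= dotmx u u.
Proof.
set w := A^T *m u.
have ww : dotmx w w = dotmx (A *m w) u by rewrite dotmx_mulmxl.
have := opnorm1_dotmx w.
have := dotmx_ge0 (u - A *m w).
rewrite !(dotmxDl, dotmxDr, dotmxNl, dotmxNr) (dotmxC u) -ww.
lra.
Qed.

(* On an eigenvalue [r] of [G = A^T A] the slack is [r (1 - r) (1 - 2 r)^2];
   it is obtained here as [|A f|^2 - |G f|^2] for [f = (1 - 2 G) e]. *)
Lemma residual_gradient_bound (e v b : 'cV[R]_d) :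
  v = e - A^T *m (A *m e) -> b = A^T *m (A *m v) ->
  dotmx v v + 4 * dotmx b b <= dotmx e e - dotmx (A *m e) (A *m e).
Proof.
set g := A^T *m (A *m e); set k := A^T *m (A *m g) => vE.
rewrite vE !mulmxBr -/g -/k => ->.
have := opnorm1_dotmx_tr (A *m (e - 2 *: g)).
have adj p q : dotmx (A *m p) (A *m q) = dotmx p (A^T *m (A *m q)).
  by rewrite dotmx_mulmxl.
have gk : A^T *m (A *m (e - 2 *: g)) = g - 2 *: k.
  by rewrite !mulmxBr -!scalemxAr.
have ek : dotmx e k = dotmx g g by rewrite -adj dotmxC adj.
rewrite !adj gk -/g.
rewrite !(dotmxDl, dotmxDr, dotmxNl, dotmxNr, dotmxZl, dotmxZr).
rewrite ek (dotmxC g e) (dotmxC k g).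
lra.
Qed.

End OpnormOne.

(** * Index sets, sparse vectors and the gradient *)

(** The optimality of [Omega] compares only sets of size exactly [s], whereas the support of [xstar]
    may be smaller; it is padded one index at a time. *)
Lemma superset_card (T : finType) (B : {set T}) (n : nat) :
  (#|B| <= n <= #|T|)%N -> exists2 C : {set T}, B \subset C & #|C| = n.
Proof.
move=> /andP[]; elim: n => [|n IHn] Bn nT.
  by exists B => //; apply/eqP; rewrite -leqn0.
move: Bn; rewrite leq_eqVlt => /orP[/eqP Bn|Bn]; first by exists B.
have [C BC Cn] := IHn Bn (ltnW nT).
have /set0Pn[i iC] : ~: C != finset.set0.
  by rewrite -card_gt0 cardsCs finset.setCK Cn subn_gt0.
exists (i |: C); first exact: fintype.subset_trans BC (finset.subsetUr _ _).
by rewrite cardsU1 Cn -finset.in_setC iC.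
Qed.

Lemma sparseB (R : realType) (d k l : nat) (u v : 'cV[R]_d) :
  sparse k u -> sparse l v -> sparse (k + l) (u - v).
Proof.
rewrite /sparse => uk vl; apply: leq_trans (leq_add uk vl).
apply: leq_trans (leq_card_setU _ _); apply: subset_leq_card.
apply/fintype.subsetP => i; rewrite !inE !mxE.
by case: (u i 0 =P 0) => [->|] //; rewrite sub0r oppr_eq0.
Qed.

Lemma sparse_coord_proj (R : realType) (d : nat) (Omega : {set 'I_d}) (z : 'cV[R]_d) :
  sparse #|Omega| (coord_proj Omega z).
Proof.
apply: subset_leq_card; apply/fintype.subsetP => i; rewrite inE mxE.
by case: ifP => // _; rewrite eqxx.
Qed.

(** The cost is quadratic, so for [h != 0] its difference quotient along a basis vector is exactly
    affine in [h], and its limit is the constant term. *)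
Lemma partial_cost (R : realType) (m d : nat) (A : 'M[R]_(m, d)) (y : 'cV[R]_m)
    (i : 'I_d) (z : 'cV[R]_d) :
  partial (cost A y) i z = - 2 * (A^T *m (y - A *m z)) i 0.
Proof.
rewrite /partial /derive; apply: cvg_lim => //.
set e : 'cV[R]_d := delta_mx i 0; set r := y - A *m z.
have -> : (A^T *m r) i 0 = dotmx (A *m e) r.
  rewrite dotmx_mulmxl dotmxE (bigD1 i) //= big1 => [|j /negPf ji].
    by rewrite [e i 0]mxE !eqxx mul1r addr0.
  by rewrite [e j 0]mxE ji mul0r.
set q := dotmx (A *m e) (A *m e); set p := dotmx _ r.
have : - 2 * p + h * q @[h --> (0 : R)^'] --> - 2 * p + 0 * q.
  apply: cvgD; first exact: cvg_cst.
  by apply: cvgMl; apply: cvg_within_filter; exact: cvg_id.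
rewrite mul0r addr0; apply: cvg_trans; apply: near_eq_cvg; near=> h.
have h_neq0 : h != 0 by near: h; exact: nbhs_dnbhs_neq.
rewrite /= /cost !norm2_sqr mulmxDr -scalemxAr.
have -> : y - (h *: (A *m e) + A *m z) = r - h *: (A *m e).
  by rewrite opprD addrCA addrC.
rewrite -/r; move: r @p => r p.
rewrite !(dotmxDl, dotmxDr, dotmxNl, dotmxNr, dotmxZl, dotmxZr).
rewrite (dotmxC r) -/p -/q /GRing.scale /=.
by field.
Unshelve. all: by end_near.
Qed.

(** * The restricted isometry constant *)

Section RestrictedIsometry.
Context (R : realType) (m d : nat) (A : 'M[R]_(m, d)).
Hypothesis A_op : opnorm A = 1.

(** Comparing a number with [inf] requires a nonempty set; since [A] is a contraction, 1 is
    admissible for every [k]. *)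
Lemma RIP_bound_neq0 (k : nat) : [set delta | is_RIP_bound A k delta] !=set0.
Proof.
exists 1; split => // u _; rewrite !norm2_sqr subrr mul0r dotmx_ge0; split => //.
by have := opnorm1_dotmx A_op u; have := dotmx_ge0 u; lra.
Qed.

Lemma ric_ge0 (k : nat) : 0 <= ric A k.
Proof. by apply: lb_le_inf; [exact: RIP_bound_neq0 | move=> delta []]. Qed.

(** Attainment of the infimum is bypassed: for [u] nonzero, the left-hand side divided by [|u|^2]
    lies below every admissible constant, hence below their infimum. *)
Lemma ric_lower_bound (k : nat) (u : 'cV[R]_d) : sparse k u ->
  dotmx u u - dotmx (A *m u) (A *m u) <= ric A k * dotmx u u.
Proof.
move=> ku; have := dotmx_ge0 u; rewrite le_eqVlt => /predU1P[uu|u_gt0].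
  by rewrite -uu mulr0 sub0r oppr_le0 dotmx_ge0.
rewrite -ler_pdivrMr //; apply: lb_le_inf; first exact: RIP_bound_neq0.
move=> delta [_ /(_ u ku)[+ _]]; rewrite !norm2_sqr ler_pdivrMr //.
lra.
Qed.

End RestrictedIsometry.

(** * One thresholding step *)

(** A kept coordinate contributes 0 to the objective and a discarded one contributes [h i], so
    optimality is a comparison of discarded sums. *)
Lemma lookahead_threshold_sum (R : realType) (m d s : nat) (A : 'M[R]_(m, d))
    (y : 'cV[R]_m) (eta : R) (z w : 'cV[R]_d)
    (h := fun i : 'I_d => z i 0 ^+ 2 - 2 * eta * partial (cost A y) i z * z i 0) :
  lookahead_threshold A y s eta z w ->
  exists2 Omega : {set 'I_d}, w = coord_proj Omega z & #|Omega| = s /\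
    forall Omega' : {set 'I_d}, #|Omega'| = s ->
      \sum_(i < d | i \notin Omega) h i <= \sum_(i < d | i \notin Omega') h i.
Proof.
have objE (Omega : {set 'I_d}) : lookahead_obj A y eta z (coord_proj Omega z) =
    cost A y z + \sum_(i < d | i \notin Omega) h i.
  congr (_ + _); rewrite [RHS]big_mkcond; apply: eq_bigr => i _.
  by rewrite /h mxE; case: (i \in Omega) => /=; ring.
move=> [ Omega [Os -> minO]]; exists Omega => //; split=> [//|] Omega' Os'.
by have := minO Omega' Os'; rewrite !objE lerD2l.
Qed.

Lemma lookahead_step (R : realType) (s d m : nat) (A : 'M[R]_(m, d))
    (xstar : 'cV[R]_d) (eta : R) (x w : 'cV[R]_d)
    (e := x - xstar) :
  opnorm A = 1 -> (s <= d)%N -> sparse s xstar -> 0 <= eta <= 1 ->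
  lookahead_threshold A (A *m xstar) s eta
    (x + A^T *m (A *m xstar - A *m x)) w ->
  norm2 (w - xstar) ^+ 2 <=
    (1 + Num.sqrt (1 + 4 * eta ^+ 2)) ^+ 2 *
    (dotmx e e - dotmx (A *m e) (A *m e)).
Proof.
move=> A_op s_le_d xs /andP[eta0 eta1].
set a := x + _ => /lookahead_threshold_sum[ Omega wE [Os minO]].
have [|C xC Cs] := @superset_card _ [set i | xstar i 0 != 0]%SET s.
  by rewrite card_ord s_le_d andbT.
set v := e - A^T *m (A *m e).
have aE : a = xstar + v.
  by rewrite /a /v /e !mulmxBr; apply/matrixP => i j; rewrite !mxE; ring.
set b := A^T *m (A *m v).
have partialE i : partial (cost A (A *m xstar)) i a = 2 * b i 0.
  rewrite partial_cost -mulmxBr -(opprB a) (_ : a - xstar = v).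
    by rewrite !mulmxN mxE mulrNN.
  by rewrite aE addrC addKr.
have xC0 i : i \notin C -> xstar i 0 = 0.
  move=> iC; apply/eqP; apply: contraNT iC => xi.
  by apply: (fintype.subsetP xC); rewrite inE.
have vbE := residual_gradient_bound A_op (erefl v) (erefl b).
set E := dotmx e e - _ in vbE *.
pose c : 'cV[R]_d :=
  \col_i (if (i \in C) && (i \notin Omega) then a i 0 - 2 * eta * b i 0 else 0).
pose z := w - xstar + c.
have vb0 := dotmx_ge0 v; have bb0 := dotmx_ge0 b.
have aiE i : a i 0 = xstar i 0 + v i 0 by rewrite aE mxE.
have ciE i : c i 0 = if (i \in C) && (i \notin Omega)
    then a i 0 - 2 * eta * b i 0 else 0 by rewrite mxE.
have ziE i : z i 0 = (if i \in Omega then a i 0 else 0) - xstar i 0 + c i 0.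
  by rewrite /z wE !mxE.
have ccE : dotmx c c <= E.
  have cc : dotmx c c <=
      dotmx (v - (2 * eta) *: b) (v - (2 * eta) *: b) + 4 * eta ^+ 2 * dotmx b b.
    (* Adding the optimality inequality makes the claim termwise. Put [h_i = a_i^2 - 4 eta a_i b_i].
       On [C] minus [Omega], [c_i^2 = h_i + 4 eta^2 b_i^2]; on [Omega] minus [C], [a_i = v_i] and
       [h_i <= (v_i - 2 eta b_i)^2]. *)
    have := minO C Cs.
    rewrite [leLHS]big_mkcond [leRHS]big_mkcond -subr_le0 -sumrB => minC.
    rewrite -[leRHS]addr0; apply: le_trans (lerD (lexx _) minC).
    rewrite !dotmxE mulr_sumr -!big_split; apply: ler_sum => i _ /=.
    have -> : (v - (2 * eta) *: b) i 0 = v i 0 - 2 * eta * b i 0.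
      by rewrite !mxE.
    rewrite ciE partialE aiE.
    have := xC0 i; move: (v i 0) (b i 0) (xstar i 0) => vi bi xi xi0.
    have := sqr_ge0 (vi - 2 * eta * bi); have := sqr_ge0 (eta * bi).
    case: (i \in C) xi0 => [_|/(_ isT) ->]; case: (i \in Omega) => /=; nra.
  have vbA : dotmx v b = dotmx (A *m v) (A *m v) by rewrite dotmx_mulmxl.
  have bbA : dotmx b b <= dotmx (A *m v) (A *m v) by exact: opnorm1_dotmx_tr.
  apply: le_trans cc (le_trans _ vbE).
  rewrite !(dotmxDl v, dotmxDr _ v, dotmxNl, dotmxNr, dotmxZl, dotmxZr).
  (* The cross term is [- 4 eta |A v|^2 <= - 4 eta |b|^2], and the remaining slack is [4 + 4 eta - 8
     eta^2 = 4 eta (1 - eta) + 4 (1 + eta) (1 - eta)] times [|b|^2]. *)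
  rewrite (dotmxC b v) vbA.
  have := ler_wpM2l eta0 bbA.
  have := mulr_ge0 (mulr_ge0 eta0 (_ : 0 <= 1 - eta)) bb0.
  have := mulr_ge0 (mulr_ge0 (_ : 0 <= 1 + eta) (_ : 0 <= 1 - eta)) bb0.
  rewrite !subr_ge0 addr_ge0 // => /(_ isT eta1) + /(_ eta1).
  set p := dotmx (A *m v) _; set q := dotmx b b; lra.
have zzE : dotmx z z <= (1 + 4 * eta ^+ 2) * E.
  apply: le_trans (_ : (1 + 4 * eta ^+ 2) * (dotmx v v + 4 * dotmx b b) <= _).
    rewrite !dotmxE [4 * (\sum_(_ < _) _)]mulr_sumr -big_split mulr_sumr.
    apply: ler_sum => i _ /=.
    rewrite ziE ciE aiE.
    have := xC0 i; move: (v i 0) (b i 0) (xstar i 0) => vi bi xi xi0.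
    (* On [C] minus [Omega] this square is the defect in Cauchy-Schwarz: [(v - 2 eta b)^2 + (eta v +
       2 b)^2 = (1 + eta^2) (v^2 + 4 b^2)]. *)
    have := sqr_ge0 (eta * vi + 2 * bi); have := sqr_ge0 (eta * bi).
    have := sqr_ge0 (eta * vi); have := sqr_ge0 bi; have := sqr_ge0 vi.
    case: (i \in C) xi0 => [_|/(_ isT) ->]; case: (i \in Omega) => /=; nra.
  by rewrite ler_wpM2l // addr_ge0 // mulr_ge0 // sqr_ge0.
have -> : w - xstar = z - c by rewrite /z addrK.
set k := Num.sqrt _.
have kk : k ^+ 2 = 1 + 4 * eta ^+ 2.
  by rewrite sqr_sqrtr // addr_ge0 // mulr_ge0 // sqr_ge0.
have k_gt0 : 0 < k.
  by rewrite sqrtr_gt0 ltr_pwDl // mulr_ge0 // sqr_ge0.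
rewrite norm2_sqr -(ler_pM2l k_gt0).
clearbody z c E.
(* [k |z - c|^2 <= (1 + k) |z|^2 + k (1 + k) |c|^2] replaces the triangle
   inequality. *)
have := dotmx_ge0 (z + k *: c).
rewrite !(dotmxDl, dotmxDr, dotmxNl, dotmxNr, dotmxZl, dotmxZr) (dotmxC c z).
rewrite -kk in zzE.
(* With [|c|^2 <= E] and [|z|^2 <= k^2 E], the weighted bound becomes [k (1 + k)^2 E]. *)
have := ler_wpM2l (ltW k_gt0) ccE.
have := ler_wpM2l (mulr_ge0 (ltW k_gt0) (ltW k_gt0)) ccE.
have := ler_wpM2l (ltW k_gt0) zzE; move: zzE.
set zz := dotmx z z; set zc := dotmx z c; set cc := dotmx c c.
lra.
Qed.

(** * Iteration of the contraction and convergence *)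

Theorem theorem3p5 (R : realType) (s d m : nat)
    (s_gt0 : (0 < s)%N) (d_gt0 : (0 < d)%N) (m_gt0 : (0 < m)%N)
    (s_le_d : (s <= d)%N)
    (A : 'M[R]_(m, d)) (A_op : opnorm A = 1)
    (xstar : 'cV[R]_d) (xstar_sparse : sparse s xstar)
    (y : 'cV[R]_m) (y_def : y = A *m xstar)
    (eta : R) (eta_ge0 : 0 <= eta) (eta_le1 : eta <= 1)
    (x a : nat -> 'cV[R]_d) (xa_ILAT : ILAT A y s eta x a)
    (ric_lt : ric A (2 * s)%N < 1 / (1 + Num.sqrt (1 + 4 * eta ^+ 2)) ^+ 2) :
  let rho := Num.sqrt (ric A (2 * s)%N) * (1 + Num.sqrt (1 + 4 * eta ^+ 2)) in
  [/\ rho < 1,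
      (forall t : nat,
         norm2 (x t - xstar) <= rho ^+ t * norm2 (x 0%N - xstar)) &
      x t @[t --> \oo] --> xstar].
Proof.
move=> rho.
have K0 : 0 < 1 + Num.sqrt (1 + 4 * eta ^+ 2) by rewrite ltr_pwDl // sqrtr_ge0.
have delta0 := ric_ge0 A_op (2 * s).
have rho0 : 0 <= rho by rewrite mulr_ge0 ?sqrtr_ge0 // ltW.
have rho2 : rho ^+ 2 = ric A (2 * s) * (1 + Num.sqrt (1 + 4 * eta ^+ 2)) ^+ 2.
  by rewrite exprMn sqr_sqrtr.
have rho1 : rho < 1.
  rewrite -(ltr_pXn2r (n := 2)) ?nnegrE // rho2 expr1n.
  by rewrite -ltr_pdivlMr ?exprn_gt0.
have [x0 xS] := xa_ILAT.
have x_sparse t : sparse s (x t).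
  case: t => [|t].
    rewrite x0 /sparse (_ : [set _ | _]%SET = finset.set0) ?cards0 //.
    by apply/setP => i; rewrite !inE mxE eqxx.
  have [_ [ Omega [<- -> _]]] := xS t; exact: sparse_coord_proj.
have step t : norm2 (x t.+1 - xstar) <= rho * norm2 (x t - xstar).
  have [aE] := xS t; rewrite aE y_def => /lookahead_step.
  move/(_ A_op s_le_d xstar_sparse); rewrite eta_ge0 eta_le1 => /(_ isT) le1.
  rewrite -(ler_pXn2r (n := 2)) ?nnegrE ?mulr_ge0 ?norm2_ge0 //.
  apply: le_trans le1 _; rewrite [leRHS]exprMn rho2 norm2_sqr [leRHS]mulrAC [leRHS]mulrC.
  (* The order [2 * s] arises because the error is a difference of two [s]-sparse vectors. *)
  rewrite ler_pM2l ?exprn_gt0 //; apply: ric_lower_bound => //.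
  by rewrite mul2n -addnn; exact: sparseB.
have bound t : norm2 (x t - xstar) <= rho ^+ t * norm2 (x 0%N - xstar).
  elim: t => [|t IHt]; first by rewrite expr0 mul1r.
  by apply: le_trans (step t) _; rewrite exprS -mulrA ler_wpM2l.
split => //.
apply/cvgrPdist_le => /= eps eps0.
have : rho ^+ t * norm2 (x 0%N - xstar) @[t --> \oo] --> 0 * norm2 (x 0%N - xstar).
  by apply: cvgMl; apply: cvg_expr; rewrite ger0_norm.
rewrite mul0r => /cvgr0Pnorm_le /(_ _ eps0); apply: filterS => t.
move=> /(le_trans (ler_norm _)) /(le_trans (bound t)) le_eps.
(* Convergence is in the sup norm, which [norm2] dominates entry by entry. *)
rewrite distrC /Num.norm /= mx_normrE; apply: bigmax_le => [|[i j] _ /=]; first exact: ltW.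
by rewrite ord1; apply: le_trans le_eps; exact: normr_coord_le_norm2.
Qed.
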